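(* Consider a $[pqrs]$ random walk on $[0,N]$ with absorbing barriers $0$ and $N$, started in $i_0$ with $0<i_0<N$. Let $m$ be the minimum and $M$ the maximum value of the random walk. Then $$P(m=0)=\frac{\xi_1^{N-i_0}-\xi_2^{N-i_0}}{\xi_1^N-\xi_2^N},$$ $$P(m=a)=(\xi_1^{N-i_0}-\xi_2^{N-i_0})\left\{\frac1{\xi_1^{N-a}-\xi_2^{N-a}}-\frac1{\xi_1^{N-a+1}-\xi_2^{N-a+1}}\right\}\quad(1\le a\le i_0),$$ $$P(M=b)=(\xi_2^{-i_0}-\xi_1^{-i_0})\left\{\frac1{\xi_2^{-b}-\xi_1^{-b}}-\frac1{\xi_2^{-b-1}-\xi_1^{-b-1}}\right\}\quad(i_0\le b\le N-1),$$ $$P(M=N)=\frac{\xi_2^{-i_0}-\xi_1^{-i_0}}{\xi_2^{-N}-\xi_1^{-N}}.$$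
   Context: Let $p,q,s>0$, $r\ge0$ with $p+q+r+s=1$. A $[pqrs]$ random walk on an interval of integers: in each state $n$ that is not an absorbing barrier, at each time unit the walk moves to $n+1$ with probability $p$, moves to $n-1$ with probability $q$, stays in $n$ for a time unit with probability $r$, and with probability $s$ is absorbed in the current state $n$ (the process terminates there). When the walk reaches an absorbing barrier it is absorbed there (the process terminates). The minimum and maximum are taken over all states visited until absorption, including the starting state and the final state. Notation: $$\xi_1=\frac{(1-r)+\sqrt{(1-r)^2-4pq}}{2q},\quad \xi_2=\frac{(1-r)-\sqrt{(1-r)^2-4pq}}{2q}.$$ *)

(* Defs.v *)
From HB Require Import structures.
From mathcomp Require Import all_boot all_order all_algebra.
From mathcomp Require Import all_classical all_reals all_analysis.
Set Implicit Arguments.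
Unset Strict Implicit.
Unset Printing Implicit Defensive.
Import Order.TTheory GRing.Theory Num.Theory.
Import numFieldNormedType.Exports.
Local Open Scope classical_set_scope.
Local Open Scope ring_scope.

Definition xi1 (R : realType) (p q r : R) : R :=
  ((1 - r) + Num.sqrt ((1 - r) ^+ 2 - 4 * p * q)) / (2 * q).

Definition xi2 (R : realType) (p q r : R) : R :=
  ((1 - r) - Num.sqrt ((1 - r) ^+ 2 - 4 * p * q)) / (2 * q).

(* The third field is the Markov property together with the transition
   probabilities, in product form: it makes sense (and is trivially true)
   also when the conditioning event has probability 0. *)
Record markov_chain (d : measure_display) (T : measurableType d) (R : realType)
    (P : probability T R) (S : finType) (x0 : S) (K : S -> S -> R)
    (X : nat -> T -> S) : Prop := MarkovChain {
  markov_measurable : forall n x, measurable [set w | X n w = x];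
  markov_init : P [set w | X 0%N w = x0] = 1%E;
  markov_step : forall n (x : nat -> S),
    P [set w | forall k, (k <= n.+1)%N -> X k w = x k] =
    (P [set w | forall k, (k <= n)%N -> X k w = x k]
       * (K (x n) (x n.+1))%:E)%E }.

(* A state is a position in [0, N] together with a flag recording whether the
   walk has been absorbed at that (interior) position by an s-step. The process
   terminates at absorption; this is encoded by letting the state stay constant
   from then on, which does not change the set of visited positions. *)
Definition walk_state (N : nat) : finType := ('I_N.+1 * bool)%type.

Definition walk_trans (R : realType) (p q r s : R) (N : nat)
    (x y : walk_state N) : R :=
  let: (i, absorbed) := x in
  let: (j, absorbed') := y in
  if [|| absorbed, i == 0%N :> nat | i == N :> nat] then (y == x)%:R
  else if absorbed' then (if j == i then s else 0)
  else if j == i.+1 :> nat then p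
  else if j.+1 == i :> nat then q
  else if j == i then r
  else 0.

Definition pqrs_walk (d : measure_display) (T : measurableType d) (R : realType)
    (P : probability T R) (p q r s : R) (N : nat) (i0 : 'I_N.+1)
    (X : nat -> T -> walk_state N) : Prop :=
  markov_chain P ((i0, false) : walk_state N) (@walk_trans R p q r s N) X.

Definition visited (T : Type) (N : nat) (X : nat -> T -> walk_state N) (w : T)
    (i : 'I_N.+1) : bool :=
  `[< exists n, (X n w).1 = i >].

(* At least one position is visited, and all are at most N, so the default
   values N and 0 of the iterated operators play no role. *)
Definition walk_min (T : Type) (N : nat) (X : nat -> T -> walk_state N)
    (w : T) : nat :=
  \big[minn/N]_(i : 'I_N.+1 | visited X w i) i.

Definition walk_max (T : Type) (N : nat) (X : nat -> T -> walk_state N)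
    (w : T) : nat :=
  (\max_(i : 'I_N.+1 | visited X w i) i)%N.

(* Main.v *)
Require Import Defs.
From HB Require Import structures.
From mathcomp Require Import all_boot all_order all_algebra.
From mathcomp Require Import all_classical all_reals all_analysis.
From mathcomp Require Import ring lra zify.
Import Order.TTheory GRing.Theory Num.Theory.
Import numFieldNormedType.Exports.
Local Open Scope classical_set_scope.
Local Open Scope ring_scope.

(** The minimum is at most [a] exactly when the walk ever enters the positions
    [<= a], and the maximum is at least [b] exactly when it ever enters the
    positions [>= b].  So the theorem is about hitting probabilities, and each
    point probability is a difference of the probabilities of two nested events
    of this kind.

    The probability of hitting a set [A], seen as a function of the starting
    position, is determined by a linear boundary value problem: it is 1 on [A],
    it is 0 at a barrier outside [A] (and after an absorption outside [A]), and
    in between it satisfies [phi i = p phi(i+1) + q phi(i-1) + r phi i].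
    Solutions are unique because of the killing probability [s > 0]: the error
    between [phi] and the probability of hitting [A] within [n] steps is
    multiplied by at most [p + q + r = 1 - s] at each step
    ([hit_within_geometric]), hence tends to 0.  On the probabilistic side, the
    probability of hitting within [n] steps obeys the one-step recursion
    [hit_within] by the Markov property ([cylinder_hits_between]), and
    continuity of the measure gives the limit ([hits_ever_prob]).  Together
    these give [walk_hits_prob].

    It remains to solve the problem.  The function [i |-> x^(-i)] satisfies the
    recurrence as soon as [q x^2 - (1 - r) x + p = 0], and the roots of this
    equation are [xi1 > xi2 > 0].  The combination of the two that vanishes at
    the far barrier, divided by its value at the edge of [A], is the solution:
    it is proportional to [xi1^(N-i) - xi2^(N-i)] for the minimum and to
    [xi2^(-i) - xi1^(-i)] for the maximum ([gap_rec]). *)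

Set Implicit Arguments.
Unset Strict Implicit.

(** * Hitting probabilities of a finite Markov chain *)

Section FiniteMarkovChain.
Context (d : measure_display) (T : measurableType d) (R : realType).
Context (P : probability T R) (S : finType) (x0 : S) (K : S -> S -> R).
Context (X : nat -> T -> S) (hX : markov_chain P x0 K X).
Context (A : pred S).

Definition cylinder (n : nat) (x : nat -> S) : set T :=
  [set w | forall k, (k <= n)%N -> X k w = x k].

Definition hits_between (n m : nat) : set T :=
  [set w | exists k, (n <= k <= n + m)%N /\ A (X k w)].

(** The probability of visiting [A] at a time [<= m] when starting from [x],
    computed by conditioning on the first step. *)
Fixpoint hit_within (m : nat) (x : S) : R :=
  if A x then 1
  else if m is m'.+1 then \sum_y K x y * hit_within m' y else 0.

Lemma measurable_state_in (k : nat) (B : pred S) :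
  measurable [set w | B (X k w)].
Proof.
have -> : [set w | B (X k w)] = \bigcup_(y in [set y | B y]) [set w | X k w = y].
  by apply/seteqP; split => [w Bw | w [y By /= ->]] //; exists (X k w).
by apply: fin_bigcup_measurable => // y _; exact: (markov_measurable hX).
Qed.

Lemma measurable_cylinder (n : nat) (x : nat -> S) : measurable (cylinder n x).
Proof.
have -> : cylinder n x = \bigcap_(k in [set k | (k <= n)%N]) [set w | X k w = x k].
  by apply/seteqP; split => [w hw k /hw | w hw k /hw].
by apply: bigcap_measurable => [|k _]; [exists 0%N | exact: (markov_measurable hX)].
Qed.

Lemma measurable_hits_between (n m : nat) : measurable (hits_between n m).
Proof.
have -> : hits_between n m =
    \bigcup_(k in [set k | (n <= k <= n + m)%N]) [set w | A (X k w)].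
  by apply/seteqP; split => [w [k [? ?]] | w [k ? ?]]; exists k.
by apply: bigcup_measurable => k _; exact: measurable_state_in.
Qed.

(** The Markov property, propagated from one step to [m] steps: given the path
    up to time [n], only the current state matters for the next [m] steps.  The
    induction on [m] splits the event according to the state at time [n + 1],
    which lengthens the prescribed path; this is why [n] and the path are
    universally quantified.  The product form avoids conditioning on a
    negligible event. *)
Lemma cylinder_hits_between (m n : nat) (x : nat -> S) :
  P (cylinder n x `&` hits_between n m) =
  (P (cylinder n x) * (hit_within m (x n))%:E)%E.
Proof.
elim: m n x => [|m IHm] n x.
  rewrite /=; case: ifPn => Ax.
    rewrite mule1; congr (P _); apply/seteqP; split => [w [] //|w hw].
    split=> //; exists n; split; first by rewrite leqnn leq_addr.
    by rewrite hw.
  rewrite mule0 -[RHS](measure0 P); congr (P _); apply/seteqP; split => // w.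
  move=> [hw [k [+ Ak]]]; rewrite addn0 -eqn_leq => /eqP nk.
  by move: Ak; rewrite -nk hw // (negbTE Ax).
rewrite /=; case: ifPn => Ax.
  rewrite mule1; congr (P _); apply/seteqP; split => [w [] //|w hw].
  split=> //; exists n; split; first by rewrite leqnn leq_addr.
  by rewrite hw.
(* The path prolonged by the state y at time n + 1. *)
pose ext y k := if (k <= n)%N then x k else y.
have extE y w : cylinder n.+1 (ext y) w <-> cylinder n x w /\ X n.+1 w = y.
  split=> [hw|[hw hy] k]; first split.
  - by move=> k kn; rewrite hw ?(leqW kn)// /ext kn.
  - by rewrite hw // /ext ltnn.
  - by rewrite leq_eqVlt ltnS => /orP[/eqP ->|kn]; rewrite /ext ?ltnn // kn hw.
have -> : cylinder n x `&` hits_between n m.+1 =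
    \bigcup_(y in [set` index_enum S])
      (cylinder n.+1 (ext y) `&` hits_between n.+1 m).
  apply/seteqP; split => [w [hw [k [/andP[nk km] Ak]]]|w [y _ [/extE[hw hy]]]].
    exists (X n.+1 w); first by rewrite /= mem_index_enum.
    split; first by apply/extE.
    exists k; split=> //; rewrite addSnnS km andbT ltn_neqAle nk andbT.
    by apply: contraNN Ax => /eqP eq_nk; rewrite -hw // eq_nk.
  move=> [k [/andP[nk km] Ak]]; split=> //; exists k; split=> //.
  by rewrite (ltnW nk) -addSnnS.
rewrite measure_fin_bigcup //; last 2 first.
- move=> y z _ _ [w [[/extE[_ <-] _] [/extE[_ <-] _]]] //.
- by move=> y _; apply: measurableI;
    [exact: measurable_cylinder | exact: measurable_hits_between].
rewrite -fsbig_seq ?index_enum_uniq //.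
have fc : P (cylinder n x) \is a fin_num.
  exact: fin_num_measure (measurable_cylinder n x).
rewrite -(fineK fc) -EFinM mulr_sumr -sumEFin; apply: eq_bigr => y _.
rewrite [LHS]IHm {2}/ext ltnn (markov_step hX).
have -> : [set w | forall k, (k <= n)%N -> X k w = ext y k] = cylinder n x.
  by apply/seteqP; split => w hw k kn; rewrite hw // /ext kn.
by rewrite -/(cylinder n x) -(fineK fc) -!EFinM /ext leqnn ltnn mulrA.
Qed.

Lemma hits_within_prob (m : nat) : P (hits_between 0 m) = (hit_within m x0)%:E.
Proof.
have cE : cylinder 0 (fun=> x0) = [set w | X 0%N w = x0].
  by apply/seteqP; split => [w hw|w hw [|k]] //; exact: hw 0%N _.
have mC := measurable_cylinder 0 (fun=> x0).
have mH := measurable_hits_between 0 m.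
have -> : P (hits_between 0 m) = (P (hits_between 0 m `\` cylinder 0 (fun=> x0))
    + P (hits_between 0 m `&` cylinder 0 (fun=> x0)))%E by exact: measureDI.
rewrite setIC cylinder_hits_between cE (markov_init hX) mul1e.
(* The paths that do not start at x0 form a negligible set. *)
rewrite -[RHS]add0e; congr (_ + _)%E; apply/eqP.
rewrite eq_le measure_ge0 andbT.
have <- : P (~` cylinder 0 (fun=> x0)) = 0%E.
  by rewrite probability_setC // cE (markov_init hX) subee.
rewrite -cE; apply: le_measure; rewrite ?inE; first exact: measurableD.
  exact: measurableC.
by move=> w [].
Qed.

(** The event of ever visiting [A] is the increasing union of the events of
    visiting it by time [m], so continuity from below applies. *)
Lemma hits_ever_prob (l : R) :
  (hit_within m x0) @[m --> \oo] --> l ->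
  P [set w | exists k, A (X k w)] = l%:E.
Proof.
move=> ul.
have <- : \bigcup_m hits_between 0 m = [set w | exists k, A (X k w)].
  apply/seteqP; split => [w [m _ [k [_ ?]]]|w [k Ak]]; first by exists k.
  by exists k => //; exists k; rewrite add0n !leqnn.
apply: (@cvg_unique _ _ (P \o hits_between 0 @ \oo)) => //=.
  apply: nondecreasing_cvg_mu => [i||m m' mm'].
  - exact: measurable_hits_between.
  - by apply: bigcup_measurable => i _; exact: measurable_hits_between.
  - apply/subsetPset => w [k [/andP[_ km] Ak]]; exists k; split=> //.
    by rewrite add0n (leq_trans km) // add0n.
have -> : P \o hits_between 0 = EFin \o (fun m => hit_within m x0).
  by apply/funext => m /=; rewrite hits_within_prob.
by apply: cvg_EFin => //; exact: nearW.
Qed.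

End FiniteMarkovChain.

(** * Hitting probabilities of the walk *)

Section Walk.
Context (R : realType) (p q r s : R) (N : nat).
Hypotheses (hp : 0 < p) (hq : 0 < q) (hs : 0 < s) (hr : 0 <= r).
Hypothesis hsum : p + q + r + s = 1.
Let K := @walk_trans R p q r s N.

Lemma walk_trans_sum_interior (f : walk_state N -> R) (i j k : 'I_N.+1) :
  k.+1 = i -> j = i.+1 :> nat ->
  \sum_y K (i, false) y * f y =
  p * f (j, false) + q * f (k, false) + r * f (i, false) + s * f (i, true).
Proof.
move=> ki ji.
have iN : (i == N :> nat) = false by apply/negbTE; have := ltn_ord j; lia.
have i0 : (i == 0%N :> nat) = false by rewrite -ki.
have pick (c : R) (l : 'I_N.+1) b :
    \sum_l' c * ((l' == l)%:R * f (l', b)) = c * f (l, b).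
  rewrite (bigD1 l) //= eqxx mul1r big1 ?addr0 // => l' /negbTE ->.
  by rewrite mul0r mulr0.
rewrite (eq_bigr (fun y => K (i, false) (y.1, y.2) * f (y.1, y.2))); last first.
  by case.
rewrite -(pair_bigA _ (fun l b => K (i, false) (l, b) * f (l, b))) /=.
(* Spreading each term of the right-hand side over all positions reduces the
   identity to one transition probability at a time. *)
rewrite -!pick -!big_split /=; apply: eq_bigr => l _.
rewrite big_bool /= iN i0 /=.
have -> : (l == i.+1 :> nat) = (l == j) by rewrite -ji.
have -> : (l.+1 == i :> nat) = (l == k) by rewrite -ki eqSS.
have [->|_] := eqVneq l j.
  have /negbTE -> : j != i by rewrite -val_eqE /= ji neq_ltn ltnSn orbT.
  have /negbTE -> : j != k by rewrite -val_eqE /= ji -ki; lia.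
  by rewrite /= ?(mulr1n, mulr0n); ring.
have [->|_] := eqVneq l k.
  have /negbTE -> : k != i by rewrite -val_eqE /= -ki; lia.
  by rewrite /= ?(mulr1n, mulr0n); ring.
by case: eqVneq => [->|_]; rewrite /= ?(mulr1n, mulr0n); ring.
Qed.

Lemma walk_trans_sum_absorbed (f : walk_state N -> R) (x : walk_state N) :
  [|| x.2, x.1 == 0%N :> nat | x.1 == N :> nat] ->
  \sum_y K x y * f y = f x.
Proof.
case: x => i b /= xabs; rewrite (bigD1 (i, b)) //= xabs eqxx mul1r.
rewrite big1 ?addr0 // => -[j c] /negbTE jx.
by have -> : ((j, c) == (i, b) :> walk_state N) = false by []; rewrite mul0r.
Qed.

Context (A : pred nat) (phi : nat -> R).
Hypothesis phiA : forall i, A i -> phi i = 1.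
Hypothesis phi0 : ~~ A 0%N -> phi 0%N = 0.
Hypothesis phiN : ~~ A N -> phi N = 0.
Hypothesis phi_harmonic : forall i, (0 < i < N)%N -> ~~ A i ->
  phi i = p * phi i.+1 + q * phi i.-1 + r * phi i.

Let u := hit_within K (fun x : walk_state N => A x.1).
(** [phi] extended to the states of the walk; the flag [true] means absorption
    in the interior, after which [A] is hit only if the walk already sits there. *)
Let h (x : walk_state N) : R := if x.2 && ~~ A x.1 then 0 else phi x.1.

Let uS m (x : walk_state N) : ~~ A x.1 ->
  u m.+1 x = \sum_y K x y * u m y.
Proof. by move=> /negbTE Ax; rewrite /u [LHS]/= Ax. Qed.

Let u_absorbed m (x : walk_state N) : ~~ A x.1 ->
  [|| x.2, x.1 == 0%N :> nat | x.1 == N :> nat] -> u m x = 0.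
Proof.
move=> nA xabs; elim: m => [|m IHm]; first by rewrite /u /= (negbTE nA).
by rewrite uS // walk_trans_sum_absorbed.
Qed.

(** At an interior state outside [A], [h] and [u n.+1] are averages of [h] and
    [u n] over the next state with the same weights; the weight [s] falls on an
    absorbed state, where both functions vanish.  So the error is averaged with
    total weight [p + q + r = 1 - s], while on [A] and at states that the walk
    cannot leave there is no error at all. *)
Lemma hit_within_geometric : exists D : R, forall n (x : walk_state N),
  `|h x - u n x| <= D * (1 - s) ^+ n.
Proof.
pose D := \sum_x `|h x - u 0%N x|.
have D0 : 0 <= D by apply: sumr_ge0 => x _; exact: normr_ge0.
have s1 : 0 <= 1 - s by rewrite -hsum addrK !addr_ge0 // ltW.
exists D; elim=> [|n IHn] [i b].
  rewrite mulr1 /D (bigD1 (i, b)) //= lerDl.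
  by apply: sumr_ge0 => x _; exact: normr_ge0.
have [Ai|nAi] := boolP (A i).
  by rewrite /h /u /= Ai andbF phiA // subrr normr0 mulr_ge0 // exprn_ge0.
have [xabs|] := boolP [|| b, i == 0%N :> nat | i == N :> nat].
  have -> : h (i, b) = 0.
    move: xabs; rewrite /h /= nAi andbT.
    case: b => //= /orP[] /eqP iE; move: nAi; rewrite iE => nA.
      exact: phi0.
    exact: phiN.
  by rewrite u_absorbed // subrr normr0 mulr_ge0 // exprn_ge0.
rewrite !negb_or => /and3P[/negbTE -> i0 iN].
have iN1 : (i.+1 < N.+1)%N by have := ltn_ord i; lia.
have i1N : (i.-1 < N.+1)%N by have := ltn_ord i; lia.
have i1K : i.-1.+1 = i by lia.
rewrite uS // (@walk_trans_sum_interior _ i (Ordinal iN1) (Ordinal i1N)) //.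
have -> : h (i, false) = p * h (Ordinal iN1, false) + q * h (Ordinal i1N, false)
    + r * h (i, false) + s * h (i, true).
  by rewrite /h /= nAi mulr0 addr0 -phi_harmonic // lt0n i0 ltn_neqAle iN -ltnS /=.
rewrite (@u_absorbed _ (i, true)) // {4}/h /= nAi !mulr0 !addr0.
have := IHn (Ordinal iN1, false); have := IHn (Ordinal i1N, false).
have := IHn (i, false).
move: (h (i, false)) (h (Ordinal iN1, false)) (h (Ordinal i1N, false)) => a1 a2 a3.
move: (u n (i, false)) (u n (Ordinal iN1, false)) (u n (Ordinal i1N, false)).
move=> b1 b2 b3; rewrite exprSr mulrA; move: (D * (1 - s) ^+ n) => E.
move=> e1 e3 e2.
have -> : p * a2 + q * a3 + r * a1 - (p * b2 + q * b3 + r * b1) =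
    p * (a2 - b2) + q * (a3 - b3) + r * (a1 - b1) by ring.
have -> : E * (1 - s) = p * E + q * E + r * E by rewrite -hsum; ring.
have le_scaled c x : 0 <= c -> `|x| <= E -> `|c * x| <= c * E.
  by move=> c0 xE; rewrite normrM ger0_norm // ler_wpM2l.
by do 2?[apply: le_trans (ler_normD _ _) _; apply: lerD];
  apply: le_scaled => //; exact: ltW.
Qed.

Lemma walk_hits_prob (d : measure_display) (T : measurableType d)
    (P : probability T R) (i0 : 'I_N.+1) (X : nat -> T -> walk_state N) :
  pqrs_walk P p q r s i0 X ->
  P [set w | exists n, A (X n w).1] = (phi i0)%:E.
Proof.
move=> hX; apply: (hits_ever_prob hX (A := fun x => A x.1)).
have [D hD] := hit_within_geometric.
have -> : phi i0 = h (i0, false) by [].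
apply/cvgrPdist_le => e e0.
have : geometric D (1 - s) @ \oo --> (0 : R).
  apply: cvg_geometric; rewrite ger0_norm; first by rewrite gtrBl.
  by rewrite -hsum addrK !addr_ge0 // ltW.
move/cvgrPdist_le => /(_ e e0); apply: filterS => n /=.
rewrite sub0r normrN; apply: le_trans; apply: le_trans (hD n _) _.
exact: ler_norm.
Qed.

End Walk.

(** * The characteristic roots *)

Section Roots.
Context (R : realType) (p q r s : R).
Hypotheses (hp : 0 < p) (hq : 0 < q) (hs : 0 < s).
Hypothesis hsum : p + q + r + s = 1.

Let oneBr : 1 - r = p + q + s. Proof. by rewrite -hsum; ring. Qed.

Let disc := (1 - r) ^+ 2 - 4 * p * q.

(** The discriminant is that of [q x^2 - (p + q) x + p], namely [(p - q)^2],
    increased by the killing; [s > 0] makes the two roots distinct. *)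
Let disc_gt0 : 0 < disc.
Proof.
have -> : disc = (p - q) ^+ 2 + s * (2 * p + 2 * q + s).
  by rewrite /disc oneBr; ring.
apply: ltr_wpDl; first exact: sqr_ge0.
by rewrite mulr_gt0 // !addr_gt0 // mulr_gt0.
Qed.

Let quadratic_root (D : R) : D ^+ 2 = disc ->
  q * ((1 - r + D) / (2 * q)) ^+ 2 = (1 - r) * ((1 - r + D) / (2 * q)) - p.
Proof.
have q0 : q != 0 by rewrite gt_eqF.
move=> DE; have -> : p = ((1 - r) ^+ 2 - D ^+ 2) / (4 * q).
  by rewrite DE /disc; field.
by field.
Qed.

Lemma xi1_root : q * xi1 p q r ^+ 2 = (1 - r) * xi1 p q r - p.
Proof. by apply: quadratic_root; rewrite sqr_sqrtr // ltW. Qed.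

Lemma xi2_root : q * xi2 p q r ^+ 2 = (1 - r) * xi2 p q r - p.
Proof. by apply: quadratic_root; rewrite sqrrN sqr_sqrtr // ltW. Qed.

Lemma xi2_gt0 : 0 < xi2 p q r.
Proof.
have r1 : 0 < 1 - r by rewrite oneBr !addr_gt0.
rewrite /xi2 divr_gt0 ?mulr_gt0 // subr_gt0 -/disc.
rewrite -ltr_sqr ?nnegrE ?sqrtr_ge0 ?(ltW r1) // sqr_sqrtr ?(ltW disc_gt0) //.
by rewrite gtrBl !mulr_gt0.
Qed.

Lemma xi2_lt_xi1 : xi2 p q r < xi1 p q r.
Proof.
rewrite /xi1 /xi2 ltr_pM2r ?invr_gt0 ?mulr_gt0 // ltrD2l gtrN //.
by rewrite sqrtr_gt0.
Qed.

End Roots.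

Section Gap.
Context (R : realType).

Definition gap (x y : R) (n : nat) : R := x ^+ n - y ^+ n.

Lemma gap_gt0 (x y : R) (n : nat) : 0 < y -> y < x -> (0 < n)%N -> 0 < gap x y n.
Proof. by move=> y0 yx n0; rewrite subr_gt0 ltrXn2r ?ltW // -lt0n. Qed.

Lemma gap_rec (p q r x y : R) (n : nat) :
  q * x ^+ 2 = (1 - r) * x - p -> q * y ^+ 2 = (1 - r) * y - p ->
  gap x y n.+1 = p * gap x y n + q * gap x y n.+2 + r * gap x y n.+1.
Proof.
move=> xE yE; rewrite /gap.
have -> : q * (x ^+ n.+2 - y ^+ n.+2) =
    (q * x ^+ 2) * x ^+ n - (q * y ^+ 2) * y ^+ n by rewrite !exprS; ring.
by rewrite xE yE !exprS; ring.
Qed.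

(** Reversing the interval exchanges [p] and [q] and inverts the roots, so the
    recurrence for the maximum follows from the one for the minimum. *)
Lemma reciprocal_root (p q r x : R) : x != 0 ->
  q * x ^+ 2 = (1 - r) * x - p -> p * x^-1 ^+ 2 = (1 - r) * x^-1 - q.
Proof.
move=> x0 xE; have -> : p = (1 - r) * x - q * x ^+ 2 by rewrite xE; ring.
by field.
Qed.

End Gap.

(** * The laws of the minimum and of the maximum *)

(** The bound [a < N] excludes the default value [N] of the iterated minimum. *)
Lemma walk_min_leP (T : Type) (N : nat) (X : nat -> T -> walk_state N) (w : T)
    (a : nat) : (a < N)%N ->
  (walk_min X w <= a)%N <-> exists n, ((X n w).1 <= a)%N.
Proof.
move=> aN; split=> [|[n Xa]].
  apply: contraPP => nex; apply/negP; rewrite -ltnNge /walk_min.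
  apply: (big_ind (fun m => a < m)%N) => // [m1 m2|i /asboolP[n Xi]].
    by rewrite leq_min => -> ->.
  by rewrite ltnNge; apply/negP => ia; apply: nex; exists n; rewrite Xi.
have vX : visited X w (X n w).1 by apply/asboolP; exists n.
apply: leq_trans Xa; rewrite /walk_min.
have := mem_index_enum (X n w).1; elim: (index_enum _) => // j t IHt.
rewrite inE big_cons => /orP[/eqP <-|/IHt IH]; first by rewrite vX geq_minl.
by case: ifP => // _; rewrite (leq_trans (geq_minr _ _)).
Qed.

(** The bound [0 < b] excludes the default value [0] of the iterated maximum. *)
Lemma walk_max_geP (T : Type) (N : nat) (X : nat -> T -> walk_state N) (w : T)
    (b : nat) : (0 < b)%N ->
  (b <= walk_max X w)%N <-> exists n, (b <= (X n w).1)%N.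
Proof.
case: b => // b _; split=> [|[n Xb]].
  apply: contraPP => nex; apply/negP; rewrite -leqNgt /walk_max.
  apply/bigmax_leqP => i /asboolP[n Xi].
  by rewrite leqNgt; apply/negP => ib; apply: nex; exists n; rewrite Xi.
apply: leq_trans Xb _; apply: (leq_bigmax_cond (F := @nat_of_ord N.+1)).
by apply/asboolP; exists n.
Qed.

Lemma measure_nested (d : measure_display) (T : measurableType d) (R : realType)
    (P : probability T R) (A B : set T) (x y : R) :
  measurable A -> measurable B -> B `<=` A -> P A = x%:E -> P B = y%:E ->
  P (A `\` B) = (x - y)%:E.
Proof.
move=> mA mB BA PA PB; rewrite measureD // ?(setIidr BA); last first.
  by rewrite [X in (X < _)%E]PA ltry.
by rewrite EFinB -PA -PB.
Qed.

Section Extrema.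
Context (d : measure_display) (T : measurableType d) (R : realType).
Context (P : probability T R) (p q r s : R) (N : nat) (i0 : 'I_N.+1).
Context (X : nat -> T -> walk_state N).
Hypotheses (hp : 0 < p) (hq : 0 < q) (hs : 0 < s) (hr : 0 <= r).
Hypothesis hsum : p + q + r + s = 1.
Hypotheses (hi0 : (0 < i0)%N) (hi0N : (i0 < N)%N).
Hypothesis hX : pqrs_walk P p q r s i0 X.

Let x1 := xi1 p q r.
Let x2 := xi2 p q r.
Let x2_gt0 : 0 < x2. Proof. exact: xi2_gt0 hsum. Qed.
Let x2_lt_x1 : x2 < x1. Proof. exact: xi2_lt_xi1 hsum. Qed.
Let x1_gt0 : 0 < x1. Proof. exact: lt_trans x2_lt_x1. Qed.
Let x1_root : q * x1 ^+ 2 = (1 - r) * x1 - p. Proof. exact: xi1_root hsum. Qed.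
Let x2_root : q * x2 ^+ 2 = (1 - r) * x2 - p. Proof. exact: xi2_root hsum. Qed.

Lemma prob_walk_min_le (a : nat) : (a <= i0)%N ->
  P [set w | (walk_min X w <= a)%N] = (gap x1 x2 (N - i0) / gap x1 x2 (N - a))%:E.
Proof.
move=> ai; have aN : (a < N)%N by exact: leq_ltn_trans hi0N.
have -> : [set w | (walk_min X w <= a)%N] =
    [set w | exists n, ((X n w).1 <= a)%N].
  by apply/seteqP; split => w /walk_min_leP; exact.
(* Truncating at a makes phi constantly 1 on the target; the value at a itself
   is the one given by the formula, so the recurrence holds up to the edge. *)
pose phi i := gap x1 x2 (N - maxn i a) / gap x1 x2 (N - a).
have g0 : gap x1 x2 (N - a) != 0 by rewrite gt_eqF // gap_gt0 // subn_gt0.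
rewrite (walk_hits_prob hp hq hs hr hsum (A := fun i => (i <= a)%N)
  (phi := phi) _ _ _ _ hX) //.
- by rewrite /phi (maxn_idPl ai).
- by move=> i ia; rewrite /phi (maxn_idPr ia) divff.
- by move=> _; rewrite /phi (maxn_idPl (ltnW aN)) subnn /gap subrr mul0r.
- move=> i /andP[i0' iN]; rewrite -ltnNge => ia.
  have E j : (a <= j)%N -> maxn j a = j by exact: maxn_idPl.
  rewrite /phi !E; try lia.
  have [n Nn] : exists n, (N - i = n.+1)%N by exists (N - i).-1; lia.
  rewrite Nn (_ : N - i.+1 = n)%N; last by lia.
  rewrite (_ : N - i.-1 = n.+2)%N; last by lia.
  by rewrite {1}(gap_rec _ x1_root x2_root); ring.
Qed.

Lemma prob_walk_max_ge (b : nat) : (i0 <= b <= N)%N ->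
  P [set w | (b <= walk_max X w)%N] = (gap x2^-1 x1^-1 i0 / gap x2^-1 x1^-1 b)%:E.
Proof.
move=> /andP[ib bN]; have b0 : (0 < b)%N by exact: leq_trans ib.
have -> : [set w | (b <= walk_max X w)%N] =
    [set w | exists n, (b <= (X n w).1)%N].
  by apply/seteqP; split => w /walk_max_geP; exact.
(* Truncated at b, the edge of the target, so that phi is 1 on all of it. *)
pose phi i := gap x2^-1 x1^-1 (minn i b) / gap x2^-1 x1^-1 b.
have g0 : gap x2^-1 x1^-1 b != 0.
  by rewrite gt_eqF // gap_gt0 ?invr_gt0 // ltf_pV2.
rewrite (walk_hits_prob hp hq hs hr hsum (A := fun i => (b <= i)%N)
  (phi := phi) _ _ _ _ hX) //.
- by rewrite /phi (minn_idPl ib).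
- by move=> i bi; rewrite /phi (minn_idPr bi) divff.
- by move=> _; rewrite /phi min0n /gap subrr mul0r.
- by rewrite bN.
- move=> [//|i] _; rewrite -ltnNge => ib'.
  have E j : (j <= b)%N -> minn j b = j by exact: minn_idPl.
  rewrite /phi /= !E; try lia.
  (* The inverse roots satisfy the equation with p and q exchanged. *)
  have y1 := reciprocal_root (lt0r_neq0 x1_gt0) x1_root.
  have y2 := reciprocal_root (lt0r_neq0 x2_gt0) x2_root.
  by rewrite {1}(gap_rec _ y2 y1); ring.
Qed.

Let measurable_walk_hits (B : pred nat) :
  measurable [set w | exists n, B (X n w).1].
Proof.
have -> : [set w | exists n, B (X n w).1] = \bigcup_n [set w | B (X n w).1].
  by apply/seteqP; split => w [n]; [exists n | move=> _ Bn; exists n].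
apply: bigcup_measurable => n _.
exact: (measurable_state_in hX n (fun x => B x.1)).
Qed.

Lemma prob_walk_min_eq (a : nat) : (0 < a <= i0)%N ->
  P [set w | walk_min X w = a] =
  (gap x1 x2 (N - i0) / gap x1 x2 (N - a)
   - gap x1 x2 (N - i0) / gap x1 x2 (N - a.-1))%:E.
Proof.
move=> /andP[a0 ai].
have mle c : (c <= i0)%N -> measurable [set w | (walk_min X w <= c)%N].
  move=> ci; have -> : [set w | (walk_min X w <= c)%N] =
      [set w | exists n, ((X n w).1 <= c)%N].
    have cN := leq_ltn_trans ci hi0N.
    by apply/seteqP; split => w /(walk_min_leP X w cN).
  exact: (measurable_walk_hits (fun i => i <= c)%N).
have pi : (a.-1 <= i0)%N by exact: leq_trans (leq_pred a) ai.
have -> : [set w | walk_min X w = a] =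
    [set w | (walk_min X w <= a)%N] `\` [set w | (walk_min X w <= a.-1)%N].
  by apply/seteqP; split => w /=; lia.
apply: measure_nested; [exact: mle|exact: mle| |exact: prob_walk_min_le|
  exact: prob_walk_min_le].
by move=> w /= wa; exact: leq_trans wa (leq_pred a).
Qed.

Lemma prob_walk_max_eq (b : nat) : (i0 <= b < N)%N ->
  P [set w | walk_max X w = b] =
  (gap x2^-1 x1^-1 i0 / gap x2^-1 x1^-1 b
   - gap x2^-1 x1^-1 i0 / gap x2^-1 x1^-1 b.+1)%:E.
Proof.
move=> /andP[ib bN].
have mge c : (i0 <= c)%N -> measurable [set w | (c <= walk_max X w)%N].
  move=> ic; have -> : [set w | (c <= walk_max X w)%N] =
      [set w | exists n, (c <= (X n w).1)%N].
    have c0 := leq_trans hi0 ic.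
    by apply/seteqP; split => w /(walk_max_geP X w c0).
  exact: (measurable_walk_hits (fun i => c <= i)%N).
have -> : [set w | walk_max X w = b] =
    [set w | (b <= walk_max X w)%N] `\` [set w | (b.+1 <= walk_max X w)%N].
  by apply/seteqP; split => w /=; lia.
apply: measure_nested; [exact: mge|apply: mge; exact: leqW| | |].
- by move=> w /=; exact: ltnW.
- by apply: prob_walk_max_ge; rewrite ib ltnW.
- by apply: prob_walk_max_ge; rewrite leqW.
Qed.

End Extrema.

Unset Implicit Arguments.
Set Strict Implicit.

Theorem theorem13 (d : measure_display) (T : measurableType d) (R : realType)
    (P : probability T R) (p q r s : R) (N : nat) (i0 : 'I_N.+1)
    (X : nat -> T -> walk_state N)
    (hp : 0 < p) (hq : 0 < q) (hs : 0 < s) (hr : 0 <= r)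
    (hsum : p + q + r + s = 1)
    (hi0 : (0 < i0)%N) (hi0N : (i0 < N)%N)
    (hX : pqrs_walk P p q r s i0 X) :
  let x1 := xi1 p q r in
  let x2 := xi2 p q r in
  [/\ P [set w | walk_min X w = 0%N] =
        ((x1 ^+ (N - i0) - x2 ^+ (N - i0)) / (x1 ^+ N - x2 ^+ N))%:E,
      forall a : nat, (1 <= a <= i0)%N ->
        P [set w | walk_min X w = a] =
        ((x1 ^+ (N - i0) - x2 ^+ (N - i0)) *
           ((x1 ^+ (N - a) - x2 ^+ (N - a))^-1
            - (x1 ^+ (N - a + 1) - x2 ^+ (N - a + 1))^-1))%:E,
      forall b : nat, (i0 <= b <= N - 1)%N ->
        P [set w | walk_max X w = b] =
        ((x2 ^- i0 - x1 ^- i0) *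
           ((x2 ^- b - x1 ^- b)^-1
            - (x2 ^- (b + 1) - x1 ^- (b + 1))^-1))%:E
    & P [set w | walk_max X w = N] =
        ((x2 ^- i0 - x1 ^- i0) / (x2 ^- N - x1 ^- N))%:E].
Proof.
move=> x1 x2.
have gE n : x2^-1 ^+ n - x1^-1 ^+ n = x2 ^- n - x1 ^- n by rewrite !exprVn.
split=> [|a ha|b hb|].
- have -> : [set w | walk_min X w = 0%N] = [set w | (walk_min X w <= 0)%N].
    by apply/seteqP; split => w /=; lia.
  by rewrite (prob_walk_min_le hp hq hs hr hsum hi0 hi0N hX) // subn0.
- rewrite (prob_walk_min_eq hp hq hs hr hsum hi0 hi0N hX) //.
  have := ltn_ord i0 => ?.
  by rewrite (_ : N - a.-1 = N - a + 1)%N ?mulrBr //; lia.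
- rewrite (prob_walk_max_eq hp hq hs hr hsum hi0 hi0N hX); last by lia.
  by rewrite /gap !gE addn1 mulrBr.
- have -> : [set w | walk_max X w = N] = [set w | (N <= walk_max X w)%N].
    apply/seteqP; split => w /= hw; first by rewrite hw.
    apply/eqP; rewrite eqn_leq hw andbT.
    by apply/bigmax_leqP => i _; rewrite -ltnS.
  rewrite (prob_walk_max_ge hp hq hs hr hsum hi0 hi0N hX) ?leqnn ?(ltnW hi0N) //.
  by rewrite /gap !gE.
Qed.
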